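(* Let $\mathfrak g$ be a solvable Lie algebra, $\mathcal X:=\mathfrak g^n$, $\mathcal W:=\mathfrak g^r$ with $n,r\ge1$. Consider the dynamics $X^+=f(X,W)$, where $f:\mathcal X\times\mathcal W\to\mathcal X$ is a Lie function with linear part $A:\mathcal X\to\mathcal X$ in the state, such that: (i) the origin of $\mathcal X$ is the unique equilibrium, i.e. for $X\in\mathcal X$, $f(X,W)=X$ for all $W\in\mathcal W$ if and only if $X=0$; (ii) there is a nilpotent ideal $\mathfrak h\subseteq\mathfrak g$ with $\mathfrak h\supseteq[\mathfrak g,\mathfrak g]$ such that $f\big((\mathfrak h^{(i)})^n,\mathcal W\big)\subseteq(\mathfrak h^{(i)})^n$ for every ideal $\mathfrak h^{(i)}$ of the lower central series of $\mathfrak h$. If $\rho(A)=0$, there exists $\beta\ge0$ such that $\|W[k]\|\le\beta$ for all $k\ge0$, and $W[k]\in\mathfrak h^r$ for all $k\ge0$, then the origin of $\mathcal X$ is semiglobally exponentially stable.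
   Context: All vector spaces are finite dimensional over $\mathbb F\in\{\mathbb R,\mathbb C\}$. $\mathfrak g$ carries a norm $\|\cdot\|$ and Cartesian powers carry the sum norm. $\rho$ denotes spectral radius. Lower central series of $\mathfrak h$: $\mathfrak h^{(1)}:=\mathfrak h$, $\mathfrak h^{(i+1)}:=[\mathfrak h^{(i)},\mathfrak h]$; $\mathfrak h$ is nilpotent if $\mathfrak h^{(p+1)}=0$ for some finite $p$. $\mathfrak g$ is solvable if its derived series $\mathfrak g_0=\mathfrak g$, $\mathfrak g_{i+1}=[\mathfrak g_i,\mathfrak g_i]$ reaches $0$. System: $X^+=f(X,W)$ means $X[k+1]=f(X[k],W[k])$, $k\ge0$, with state $X=(X_1,\dots,X_n)\in\mathcal X$ and exogenous signal $W=(W_1,\dots,W_r)\in\mathcal W$ that does not depend on $X$. A word $\omega$ of length $|\omega|$ is a nested bracket $[Y_{\omega_1},[Y_{\omega_2},[\dots,Y_{\omega_{|\omega|}}]\cdots]$ with letters $Y_{\omega_j}$ in $\widetilde X\cup\widetilde W$, where $\widetilde X=\{X_1,\dots,X_n\}$ and $\widetilde W=\{W_1,\dots,W_r\}$. A Lie function is a function whose components are (possibly infinite) linear combinations of words in its arguments. Under the stated hypotheses the dynamics are written as $f(X,W)=AX+\sum_\omega c_\omega\otimes\omega$, where $A:\mathcal X\to\mathcal X$ is linear, the sum is over words of length at least $2$, every word has at least one letter in $\widetilde X$, and $c_\omega\in\mathbb F^n$ (with $\mathfrak g^n\cong\mathbb F^n\otimes\mathfrak g$). Semiglobal exponential stability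 of the origin: for all $M>0$ there exist $\alpha\ge0$, $\lambda<1$ such that if $\|X[0]\|\le M$ then $\|X[k]\|\le\alpha\lambda^k\|X[0]\|$ for all $k\ge0$. *)

(* Defs.v *)
From HB Require Import structures.
From mathcomp Require Import all_boot all_order all_algebra.
From mathcomp Require Import complex.
From mathcomp Require Import all_classical all_reals all_analysis.
Import Order.TTheory GRing.Theory Num.Theory numFieldNormedType.Exports.

Set Implicit Arguments.
Unset Strict Implicit.
Unset Printing Implicit Defensive.

Local Open Scope ring_scope.
Local Open Scope classical_set_scope.

(* Finite-dimensional Lie algebras over a field. *)
HB.mixin Record Vector_isLieAlgebra (K : fieldType) g of Vector K g := {
  lie : g -> g -> g;
  lie_linearl : forall (a : K) (x y z : g),
    lie (a *: x + y) z = a *: lie x z + lie y z;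
  lie_linearr : forall (a : K) (x y z : g),
    lie z (a *: x + y) = a *: lie z x + lie z y;
  lie_alternating : forall x : g, lie x x = 0;
  lie_jacobi : forall x y z : g,
    lie x (lie y z) + lie y (lie z x) + lie z (lie x y) = 0 }.

#[short(type="lieAlgebraType")]
HB.structure Definition LieAlgebra (K : fieldType) :=
  { g of Vector_isLieAlgebra K g & Vector K g }.

Section LieTheory.
Variables (K : fieldType) (g : lieAlgebraType K).
Implicit Types U V h : {vspace g}.

(* [U, V], the span of the brackets of elements of U with elements of V
   (by bilinearity, bases of U and V suffice, as for prodv in falgebra). *)
Definition lie_span U V : {vspace g} :=
  <<[seq lie u v | u <- vbasis U, v <- vbasis V]>>%VS.

Definition is_ideal h : Prop :=
  forall x y : g, y \in h -> lie x y \in h.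

(* Indexed from 0: lower_central h i is the term written h^(i+1), so that
   lower_central h 0 = h. *)
Definition lower_central h (i : nat) : {vspace g} :=
  iter i (fun U => lie_span U h) h.

Definition is_nilpotent h : Prop := exists p, lower_central h p = 0%VS.

Definition derived_series (i : nat) : {vspace g} :=
  iter i (fun U => lie_span U U) fullv.

Definition is_solvable : Prop := exists i, derived_series i = 0%VS.

End LieTheory.

Arguments is_solvable {K} g.

(* The scalars: the field is R or C = R[i]. *)
Variant base_field := RealField | ComplexField.

Definition scalar_field (R : realType) (k : base_field) : numFieldType :=
  match k with RealField => R | ComplexField => R[i]%C end.

Definition to_complex (R : realType) (k : base_field) : scalar_field R k -> R[i]%C :=
  match k with
  | RealField => fun x : R => (x%:C)%C
  | ComplexField => fun z : R[i]%C => z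
  end.

(* The norm of R[i] takes its (real) values in R[i]. *)
Definition cmod (R : realType) (z : R[i]%C) : R := complex.Re `|z|.

Record is_norm (R : realType) (k : base_field) (V : lmodType (scalar_field R k))
    (nrm : V -> R) : Prop := {
  norm_triangle : forall x y, nrm (x + y) <= nrm x + nrm y;
  norm_scale : forall a x, nrm (a *: x) = cmod (to_complex a) * nrm x;
  norm_definite : forall x, nrm x = 0 -> x = 0 }.

Definition sum_norm (R : realType) (V : Type) (nrm : V -> R) (m : nat)
    (X : {ffun 'I_m -> V}) : R := \sum_i nrm (X i).

(* The eigenvalues are taken in C even when the scalars are real.  The value is
   0 on the zero space, where there are no eigenvalues. *)
Definition spectral_radius (R : realType) (k : base_field)
    (V : vectType (scalar_field R k)) (A : 'End(V)) : R :=
  sup [set cmod mu | mu in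
        [set mu : R[i]%C |
          eigenvalue (map_mx (@to_complex R k)
            (passmx.mxof (vbasis {:V}) (vbasis {:V}) A)) mu]].

(* The letter inl i stands for X_i and the letter inr j for W_j. *)
Definition letter (n r : nat) : finType := ('I_n + 'I_r)%type.

Definition is_state_letter (n r : nat) (l : letter n r) : bool :=
  if l is inl _ then true else false.

Section LieFunction.
Variables (R : realType) (k : base_field) (g : lieAlgebraType (scalar_field R k)).
Variables (n r : nat).
Implicit Types (X : {ffun 'I_n -> g}) (W : {ffun 'I_r -> g}).

Definition eval_letter X W (l : letter n r) : g :=
  match l with inl i => X i | inr j => W j end.

(* [Y_l, [Y_l1, [..., Y_lm]...]] for the nonempty word l :: w, w = l1 ... lm. *)
Fixpoint nested_bracket X W (l : letter n r) (w : seq (letter n r)) : g :=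
  if w is l' :: w' then lie (eval_letter X W l) (nested_bracket X W l' w')
  else eval_letter X W l.

Definition eval_word X W (w : seq (letter n r)) : g :=
  if w is l :: w' then nested_bracket X W l w' else 0.

(* The sum of the terms c_w (x) w over the words w of length m with at least one
   letter among the X_i; c w : 'I_n -> F is the vector c_w of F^n. *)
Definition words_of_length (c : seq (letter n r) -> 'I_n -> scalar_field R k)
    (m : nat) X W : {ffun 'I_n -> g} :=
  \sum_(w : m.-tuple (letter n r) | has (@is_state_letter n r) w)
    [ffun i => c w i *: eval_word X W w].

(* f(X, W) = A X + sum_w c_w (x) w over the words w of length at least 2 with at
   least one letter among the X_i.  There are finitely many words of each
   length, and the possibly infinite sum is taken in order of increasing
   length; it is only required to converge pointwise. *)
Definition lie_function_with_linear_part (nrm : g -> R)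
    (A : 'End({ffun 'I_n -> g}))
    (f : {ffun 'I_n -> g} -> {ffun 'I_r -> g} -> {ffun 'I_n -> g}) : Prop :=
  exists c : seq (letter n r) -> 'I_n -> scalar_field R k, forall X W,
    (fun N : nat => sum_norm nrm
       (A X + \sum_(2 <= m < N) words_of_length c m X W - f X W))
      @ \oo --> (0 : R).

(* The origin is the only X fixed by f(., W) for all W simultaneously. *)
Definition origin_unique_equilibrium
    (f : {ffun 'I_n -> g} -> {ffun 'I_r -> g} -> {ffun 'I_n -> g}) : Prop :=
  forall X, (forall W, f X W = X) <-> X = 0.

Definition in_power (m : nat) (h : {vspace g}) (X : {ffun 'I_m -> g}) : Prop :=
  forall i, X i \in h.

Definition preserves_lower_central (h : {vspace g})
    (f : {ffun 'I_n -> g} -> {ffun 'I_r -> g} -> {ffun 'I_n -> g}) : Prop :=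
  forall (i : nat) X W,
    in_power (lower_central h i) X -> in_power (lower_central h i) (f X W).

Definition is_trajectory
    (f : {ffun 'I_n -> g} -> {ffun 'I_r -> g} -> {ffun 'I_n -> g})
    (W : nat -> {ffun 'I_r -> g}) (X : nat -> {ffun 'I_n -> g}) : Prop :=
  forall t, X t.+1 = f (X t) (W t).

Definition semiglobally_exponentially_stable (nrm : g -> R)
    (f : {ffun 'I_n -> g} -> {ffun 'I_r -> g} -> {ffun 'I_n -> g})
    (W : nat -> {ffun 'I_r -> g}) : Prop :=
  forall M : R, 0 < M ->
    exists alpha lambda : R, [/\ 0 <= alpha, 0 <= lambda < 1 &
      forall X : nat -> {ffun 'I_n -> g}, is_trajectory f W X ->
        sum_norm nrm (X 0%N) <= M ->
        forall t, sum_norm nrm (X t)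
                  <= alpha * lambda ^+ t * sum_norm nrm (X 0%N)].

End LieFunction.

(* Main.v *)
Require Import Defs.
From HB Require Import structures.
From mathcomp Require Import all_boot all_order all_algebra.
From mathcomp Require Import complex qpoly ring lra zify.
From mathcomp Require Import all_classical all_reals all_analysis.
Import Order.TTheory GRing.Theory Num.Theory numFieldNormedType.Exports.

Set Implicit Arguments.
Unset Strict Implicit.
Unset Printing Implicit Defensive.

Local Open Scope ring_scope.
Local Open Scope classical_set_scope.

(** Why the origin is stable: every trajectory reaches it in finite time.
    As [A] has spectral radius zero, it is nilpotent (Cayley-Hamilton,
    [nilpotent_of_spectral_radius0]).  Consider the chain formed by the Lie
    algebra, [h], and the further terms of the lower central series of [h].
    A word of length at least two, with a state letter, whose state letters are
    in one term of the chain and whose signal letters are in [h], lies in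
    the next term ([word_ideal_chain]).  So, modulo the next term, a trajectory
    that has entered a term follows the linear map [A], and after [d] steps, [d]
    being the dimension of the state space, it is in the next term
    ([deadbeat]).  As [h] is nilpotent, the state is zero from some time [T] on,
    and [T] does not depend on the initial state.  Any positive rate below one
    then works, provided that [|X[t]| <= C_t |X[0]|] for the finitely many
    [t < T] and all initial states in a given ball.

    Such an estimate follows by iteration from a bound [|f(X, W)| <= C |X|] on
    balls, for a fixed [W] ([lie_function_linear_growth]), and this is the
    analytic heart of the proof.  The first states need not be in [h], so the
    series of words is truly infinite, and it is only known to converge
    pointwise, in order of increasing length.  Let [P_m] be the sum of the words
    of length [m].  It is a polynomial map of degree at most [m] in [X], and by
    homogeneity in [(X, W)] the quantities [l ^ m |P_m(X, W)|] are bounded in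
    [m], for each [X] and each [l > 0].  The passage to bounds uniform
    in [X] rests on a Remez-type inequality ([poly_fun_remez]): a polynomial of
    degree [m] that is at most [B] on a subset of the unit segment of measure
    more than one half is at most a constant times [K ^ m B] on the whole
    segment, where [K] is absolute.  Continuity of Lebesgue measure provides
    such a subset, and [K ^ m] is absorbed by the freedom in [l]
    ([pointwise_uniform]).  The argument is repeated along a real basis of the
    state space ([pointwise_uniform_box], [pointwise_uniform_ball]), and once
    more for the quotients [P_m(s Y, W) / s], which yields the factor [|X|]
    ([pointwise_uniform_linear]). *)

(** * Lagrange interpolation at spaced nodes *)

Section Lagrange.
Variables (R : realType) (x : nat -> R) (e : R).
Hypothesis e_gt0 : 0 < e.
Hypothesis x_gap : forall i, x i + e <= x i.+1.

Lemma spaced_dist i j : (i <= j)%N -> (j - i)%:R * e <= x j - x i.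
Proof.
move=> /subnKC <-; move: (j - i)%N => d; rewrite addKn.
elim: d => [|d IH]; first by rewrite mul0r addn0 subrr.
have := x_gap (i + d); rewrite addnS; move: IH.
by rewrite -natr1 mulrDl mul1r; lra.
Qed.

Lemma spaced_norm (i j : nat) : `|i - j|%N%:R * e <= `|x i - x j|.
Proof.
wlog le_ij : i j / (i <= j)%N.
  move=> H; case/orP: (leq_total i j) => [/H//|/H].
  by rewrite distnC distrC.
rewrite distrC distnEr //.
exact: le_trans (spaced_dist le_ij) (ler_norm _).
Qed.

Lemma spaced_inj : injective x.
Proof.
move=> i j xij; have := spaced_norm i j; rewrite xij subrr normr0 pmulr_lle0 //.
by rewrite lern0 distn_eq0 => /eqP.
Qed.

(** The value at [t] of the Lagrange polynomial of the node [x i], for the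
    nodes [x 0], ..., [x m]. *)
Definition lagrange_coef m (i : nat) (t : R) : R :=
  \prod_(j < m.+1 | j != i :> nat) ((t - x j) / (x i - x j)).

Lemma lagrange_monomial m k t : (k <= m)%N ->
  t ^+ k = \sum_(i < m.+1) lagrange_coef m i t * x i ^+ k.
Proof.
move=> km; have := @lagrange_gen _ m.+1 x isT spaced_inj 'X^k.
rewrite size_polyXn => /(_ km) /(congr1 (fun p => p.[t])).
rewrite hornerXn horner_sum => ->; apply: eq_bigr => i _.
rewrite hornerM hornerC hornerXn lagrangeE //; last exact: spaced_inj.
rewrite hornerM hornerC mulrC; congr (_ * _).
rewrite !horner_prod mulrC -prodfV -big_split /=.
by apply: eq_bigr => j _; rewrite !hornerXsubC.
Qed.

Lemma prod_distn m i : (i <= m)%N ->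
  (\prod_(j < m.+1 | j != i :> nat) `|i - j|)%N = (i`! * (m - i)`!)%N.
Proof.
move=> im.
rewrite -(big_mkord (fun j => j != i) (fun j => `|i - j|%N)).
rewrite (big_cat_nat (n := i)) //=; last exact: leqW.
rewrite [X in (_ * X)%N]big_ltn_cond ?ltnS // eqxx /=; congr (_ * _)%N.
  rewrite big_mkcond fact_prod big_add1 /= big_nat_rev /=.
  rewrite !big_mkord; apply: eq_bigr => j _.
  by have := ltn_ord j; case: eqVneq => /=; lia.
rewrite fact_prod !big_add1 /= -{1}(add0n i) big_addn big_mkcond.
rewrite !big_mkord; apply: eq_bigr => j _; case: eqVneq => /=; lia.
Qed.

Lemma lagrange_coef_bound m i t : (i <= m)%N -> 0 <= t <= 1 ->
  (forall j, (j <= m)%N -> 0 <= x j <= 1) ->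
  `|lagrange_coef m i t| <= (e ^- m) * ((i`! * (m - i)`!)%:R)^-1.
Proof.
move=> im /andP[t0 t1] x01.
have -> : e ^- m = \prod_(j < m.+1 | j != i :> nat) e^-1.
  rewrite prodr_const -exprVn; congr (_ ^+ _).
  transitivity #|predC1 (inord i : 'I_m.+1)|; first by rewrite cardC1 card_ord.
  by apply: eq_card => j; rewrite !inE -val_eqE /= inordK.
rewrite -(prod_distn im) natr_prod -prodfV -big_split /= normr_prod.
apply: ler_prod => j ji; rewrite normr_ge0 /= normrM normfV.
rewrite -invfM -[leRHS]mul1r; apply: ler_pM => //.
- have /andP[] := x01 j (ltn_ord j); rewrite ler_norml; lra.
- rewrite lef_pV2 ?posrE; first by rewrite mulrC; exact: spaced_norm.
  + by rewrite normr_gt0 subr_eq0; apply: contra ji => /eqP /spaced_inj ->.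
  + by rewrite mulr_gt0 // ltr0n lt0n distn_eq0 eq_sym.
Qed.

(** The spacing [e] will be about [1 / 2m], and [m ^ m / m!] grows only
    geometrically: this is what makes the constant of the Remez inequality
    below geometric in the degree.  The binomial coefficients appear because
    the denominators of the Lagrange coefficients are at least
    [e ^ m * i! * (m - i)!]. *)
Lemma lagrange_coef_sum_bound m t : 0 <= t <= 1 ->
  (forall j, (j <= m)%N -> 0 <= x j <= 1) ->
  \sum_(i < m.+1) `|lagrange_coef m i t| <= (2 / e) ^+ m / m`!%:R.
Proof.
move=> t01 x01.
apply: (@le_trans _ _ (\sum_(i < m.+1) e ^- m * ((i`! * (m - i)`!)%:R)^-1)).
  by apply: ler_sum => i _; apply: lagrange_coef_bound => //; rewrite -ltnS.
rewrite -mulr_sumr expr_div_n [2 ^+ m * _]mulrC -mulrA.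
rewrite ler_pM2l ?invr_gt0 ?exprn_gt0 //.
have -> : 2 ^+ m / m`!%:R = \sum_(i < m.+1) 'C(m, i)%:R / m`!%:R :> R.
  rewrite -mulr_suml; congr (_ / _).
  have := exprDn (1 : R) 1 m; rewrite -[1 + 1]/(2%:R) => ->.
  by apply: eq_bigr => i _; rewrite !expr1n mul1r.
apply: ler_sum => i _.
have im : (i <= m)%N by rewrite -ltnS.
rewrite -(bin_fact im) [X in _ / X]natrM invfM mulrA mulfV ?mul1r //.
by rewrite pnatr_eq0 -lt0n bin_gt0.
Qed.
End Lagrange.

(** * Spaced points in a set of positive measure *)

Section SpacedPoints.
Variable R : realType.
Local Notation mu := (@lebesgue_measure R).

Lemma closed_min (S : set R) a : closed S -> S !=set0 -> lbound S a ->
  exists2 y, S y & lbound S y.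
Proof.
move=> clS S0 aS; exists (inf S).
  apply: (itv_closed_infimums S0 clS); split.
    by apply: ge_inf; exists a.
  by move=> b; exact: lb_le_inf.
by apply: ge_inf; exists a.
Qed.

(** Greedy choice: the least point [y] of [E] that is at least [a] is taken, and
    discarding [y, y + e] costs at most [e] of the measure.  Closedness of
    [E] makes the least point exist.  The sequence continues past [m] with the
    same spacing, possibly outside [E], so that it can serve as an injective sequence
    of nodes. *)
Lemma spaced_points (E : set R) (e a : R) m : closed E -> 0 < e ->
  ((m%:R * e)%:E < mu (E `&` `[a, +oo[))%E ->
  exists x : nat -> R,
    [/\ a <= x 0%N, forall i, x i + e <= x i.+1
      & forall i, (i <= m)%N -> E (x i)].
Proof.
move=> clE e_gt0.
have first_point b k : ((k%:R * e)%:E < mu (E `&` `[b, +oo[))%E ->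
    exists2 y, E y & b <= y /\ forall z, E z -> b <= z -> y <= z.
  move=> kE; set S := E `&` `[b, +oo[.
  have clS : closed S by apply: closedI => //; exact: rray_closed.
  have S0 : S !=set0.
    apply/set0P/eqP => S0; move: kE; rewrite -/S S0 measure0 lte_fin.
    by rewrite ltNge mulr_ge0 // ltW.
  have bS : lbound S b by move=> z [_]; rewrite /= in_itv /= andbT.
  have [y [Ey by_] yl] := closed_min clS S0 bS.
  exists y => //; split; first by move: by_; rewrite /= in_itv /= andbT.
  by move=> z Ez bz; apply: yl; split=> //=; rewrite in_itv /= andbT.
elim: m a => [|m IH] a mE; have [y Ey [ay yl]] := first_point _ _ mE.
  exists (fun i => y + i%:R * e); rewrite mul0r addr0; split=> //.
  - by move=> i; rewrite -natr1 mulrDl mul1r addrA.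
  - by case=> // _; rewrite mul0r addr0.
have mE' : ((m%:R * e)%:E < mu (E `&` `[(y + e)%R, +oo[))%E.
  rewrite ltNge; apply/negP => le_m; move: mE; apply/negP; rewrite -leNgt.
  have mE1 : measurable (E `&` `[(y + e)%R, +oo[).
    by apply: measurableI => //; exact: measurable_realfun.closed_measurable.
  apply: (@le_trans _ _ (mu (`[y, y + e] `|` (E `&` `[(y + e)%R, +oo[)))).
    apply: le_measure; rewrite ?inE.
    + by apply: measurableI => //; exact: measurable_realfun.closed_measurable.
    + exact: measurableU.
    + move=> z [Ez]; rewrite /= !in_itv /= !andbT => az.
      case: (leP z (y + e)) => zy; [left|right]; first by rewrite yl.
      by split => //; rewrite ltW.
  have mI : measurable (`[y, (y + e)%R] : set R) by [].
  have muI : mu `[y, (y + e)%R] = e%:E.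
    by rewrite lebesgue_measure_itv /= lte_fin ltrDl e_gt0 -EFinB addrC addKr.
  apply: le_trans (measureU2 mu mI mE1) _.
  by rewrite [X in (X + _ <= _)%E]muI -nat1r mulrDl mul1r EFinD leeD2l.
have [x [x0 xs Ex]] := IH _ mE'.
exists (fun i => if i is j.+1 then x j else y); split=> //.
  by case.
by case.
Qed.
End SpacedPoints.

(** * Vector-valued polynomials in a real variable *)

Section PolynomialFunctions.
Variables (R : realType) (F : fieldType) (emb : {rmorphism R -> F}).
Variables (U : lmodType F) (N : U -> R).
Hypothesis N_triangle : forall x y, N (x + y) <= N x + N y.
Hypothesis N_scale : forall (t : R) x, N (emb t *: x) = `|t| * N x.

(** Real polynomials of degree at most [m] with coefficients in [U], where the
    real variable acts through the embedding of the reals in the field. *)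
Definition poly_fun (m : nat) (q : R -> U) : Prop :=
  exists a : nat -> U, forall t, q t = \sum_(j < m.+1) emb (t ^+ j) *: a j.

Lemma seminorm0 : N 0 = 0.
Proof. by rewrite -[0 in LHS](scale0r 0) -(rmorph0 emb) N_scale normr0 mul0r. Qed.

Lemma seminormN x : N (- x) = N x.
Proof. by rewrite -scaleN1r -(rmorphN1 emb) N_scale normrN1 mul1r. Qed.

Lemma seminorm_ge0 x : 0 <= N x.
Proof. by have := N_triangle x (- x); rewrite subrr seminorm0 seminormN; lra. Qed.

Lemma ler_seminorm_sum (I : Type) (s : seq I) (P : pred I) (G : I -> U) :
  N (\sum_(i <- s | P i) G i) <= \sum_(i <- s | P i) N (G i).
Proof.
elim/big_rec2: _ => [|i y x _ le_xy]; first by rewrite seminorm0.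
by apply: le_trans (N_triangle _ _) _; rewrite lerD2l.
Qed.

Lemma ler_seminorm_dist x y : `|N x - N y| <= N (x - y).
Proof.
have := N_triangle (x - y) y; have := N_triangle (y - x) x.
by rewrite !subrK -(seminormN (y - x)) opprB ler_norml; lra.
Qed.

Lemma cvg_norm_lincomb (T : Type) (G : set_system T) m (c : 'I_m -> T -> R)
    (c0 : 'I_m -> R) (a : 'I_m -> U) : Filter G ->
  (forall j, c j s @[s --> G] --> c0 j) ->
  N (\sum_j emb (c j s) *: a j) @[s --> G] --> N (\sum_j emb (c0 j) *: a j).
Proof.
move=> FG cvc.
have : \sum_j `|c j s - c0 j| * N (a j) @[s --> G] -->
    \sum_j `|c0 j - c0 j| * N (a j).
  apply: cvg_big => [|j _]; first exact: add_continuous.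
  by apply: cvgMl; apply: cvg_norm; apply: cvgB; [exact: cvc|exact: cvg_cst].
have -> : \sum_j `|c0 j - c0 j| * N (a j) = 0 :> R.
  by rewrite big1 // => j _; rewrite subrr normr0 mul0r.
move=> g0.
apply/cvgrPdist_le => e e0; have /cvgrPdist_le/(_ e e0) := g0.
apply: filterS => s; rewrite sub0r normrN.
rewrite ger0_norm ?sumr_ge0 // => [|j _]; last by rewrite mulr_ge0 ?seminorm_ge0.
apply: le_trans; rewrite distrC; apply: le_trans (ler_seminorm_dist _ _) _.
rewrite -sumrB; apply: le_trans (ler_seminorm_sum _ _ _) _; apply: ler_sum => j _.
by rewrite -scalerBl -rmorphB N_scale.
Qed.

Lemma poly_fun_continuous m q : poly_fun m q -> continuous (N \o q).
Proof.
move=> [a qE] t.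
have -> : N \o q = fun t => N (\sum_(j < m.+1) emb (t ^+ j) *: a j).
  by apply/funext => s /=; rewrite qE.
apply: (@cvg_norm_lincomb _ (nbhs t) m.+1 (fun j s => s ^+ j) (fun j => t ^+ j) a).
by move=> j; exact: exprn_continuous.
Qed.

(** The coefficients of [q] are vectors, but interpolation only concerns the
    real monomials, where the scalar identity applies. *)
Lemma poly_fun_lagrange m q x e t : poly_fun m q -> 0 < e ->
  (forall i, x i + e <= x i.+1) ->
  q t = \sum_(i < m.+1) emb (lagrange_coef x m i t) *: q (x i).
Proof.
move=> [a qE] e0 x_gap; rewrite qE.
under [RHS]eq_bigr do rewrite qE scaler_sumr.
rewrite exchange_big /=; apply: eq_bigr => j _.
rewrite (lagrange_monomial e0 x_gap t (_ : (j <= m)%N)) -1?ltnS //.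
rewrite rmorph_sum scaler_suml; apply: eq_bigr => i _.
by rewrite rmorphM scalerA.
Qed.

Lemma expR_ge_exp_coeff (y : R) m : 0 <= y -> y ^+ m / m`!%:R <= expR y.
Proof.
case: m => [|m] y0; first by rewrite expr0 fact0 divr1; have := expR_ge1Dx y; lra.
by apply: le_trans (expR_ge1Dxn m y0); rewrite lerDr.
Qed.

(** A Remez-type inequality.  A set of measure more than [1 / 2] in the unit
    segment contains [m + 1] points at pairwise distances at least
    [1 / (2 (m + 1))], and interpolation there costs
    [(4 (m + 1)) ^ m / m! <= 4 ^ m * e ^ (m + 1)].  It is essential that
    the base [4 e] does not depend on the set. *)
Lemma poly_fun_remez m q (E : set R) B : poly_fun m q ->
  closed E -> E `<=` `[0, 1] -> ((1 / 2)%:E < lebesgue_measure E)%E ->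
  (forall s, E s -> N (q s) <= B) ->
  forall t, 0 <= t <= 1 -> N (q t) <= (4 * expR 1) ^+ m * (expR 1 * B).
Proof.
move=> qm clE E01 muE EB t t01.
pose e : R := (2 * m.+1%:R)^-1.
have m1 : 0 < m.+1%:R :> R by rewrite ltr0n.
have e0 : 0 < e by rewrite invr_gt0 mulr_gt0.
have [|x [_ x_gap Ex]] := @spaced_points R E e 0 m clE e0.
  apply: le_lt_trans (_ : _ <= (1 / 2)%:E)%E _.
    rewrite lee_fin /e invfM mulrCA [1 / 2]mulrC ler_pM2l ?invr_gt0 //.
    by rewrite ler_pdivrMr // mul1r ler_nat.
  rewrite (_ : E `&` _ = E) //; apply/setIidPl => s /E01 /=.
  by rewrite !in_itv /= andbT => /andP[].
have B0 : 0 <= B by apply: le_trans (EB _ (Ex 0%N isT)); exact: seminorm_ge0.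
have x01 j : (j <= m)%N -> 0 <= x j <= 1.
  by move=> /Ex /E01; rewrite /= in_itv.
rewrite (poly_fun_lagrange t qm e0 x_gap).
apply: le_trans (ler_seminorm_sum _ _ _) _.
apply: (@le_trans _ _ (\sum_(i < m.+1) `|lagrange_coef x m i t| * B)).
  apply: ler_sum => i _; rewrite N_scale ler_wpM2l // EB //.
  by apply: Ex; rewrite -ltnS.
rewrite -mulr_suml mulrA ler_wpM2r //.
apply: le_trans (lagrange_coef_sum_bound e0 x_gap t01 x01) _.
have -> : 2 / e = 4 * m.+1%:R by rewrite /e invrK; ring.
rewrite !exprMn -!mulrA ler_pM2l ?exprn_gt0 //.
apply: le_trans (expR_ge_exp_coeff _ (ltW m1)) _.
by rewrite -[m.+1%:R]mulr1 expRM_natl exprSr.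
Qed.

(** The sets where all [(l K) ^ d i * N (q i t)] are at most [n] increase to the
    segment, so one of them has measure more than [1 / 2]; the Remez inequality
    then loses the factor [K ^ d i], which the freedom in [l] absorbs.  A
    Baire category argument would not be enough: it gives an interval whose
    length depends on [l], hence a loss that [l] need not absorb.
    The index set is arbitrary, possibly uncountable: the induction over
    directions below moves real parameters into the index. *)
Lemma pointwise_uniform (I : Type) (d : I -> nat) (q : I -> R -> U) :
  (forall i, poly_fun (d i) (q i)) ->
  (forall l t : R, 0 < l -> 0 < t <= 1 ->
     exists B, forall i, l ^+ d i * N (q i t) <= B) ->
  forall l : R, 0 < l ->
     exists B, forall i (t : R), 0 <= t <= 1 -> l ^+ d i * N (q i t) <= B.
Proof.
move=> qd ptw l l0.
(* The loss per degree in the Remez inequality. *)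
pose K : R := 4 * expR 1.
have K0 : 0 < K by rewrite mulr_gt0 ?expR_gt0.
have lK0 : 0 < l * K by rewrite mulr_gt0.
pose E (n : nat) : set R :=
  `[0, 1] `&` \bigcap_(i in [set: I]) [set t | N (q i t) <= n%:R / (l * K) ^+ d i].
have clE n : closed (E n).
  apply: closedI; first exact: itv_closed.
  apply: closed_bigI => i _.
  have /continuous_closedP := poly_fun_continuous (qd i).
  by move=> /(_ _ (@closed_le _ (n%:R / (l * K) ^+ d i))).
have mE n : measurable (E n) by exact: measurable_realfun.closed_measurable.
have cvE : (lebesgue_measure \o E) n @[n --> \oo] -->
    lebesgue_measure (\bigcup_n E n).
  apply: nondecreasing_cvg_mu => //; first exact: bigcupT_measurable.
  move=> n p np; apply/subsetPset => t [t01 Et]; split=> // i _ /=.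
  apply: (le_trans (Et i Logic.I)).
  by rewrite ler_pM2r ?ler_nat // invr_gt0 exprn_gt0.
have [n muE] : exists n, ((1 / 2)%:E < lebesgue_measure (E n))%E.
  apply/not_existsP => small.
  have : (lebesgue_measure (\bigcup_n E n) <= (1 / 2)%:E)%E.
    rewrite -(cvg_lim _ cvE) //; apply: lime_le; first exact: cvgP cvE.
    by apply: nearW => n; rewrite leNgt; apply/negP; exact: small.
  apply/negP; rewrite -ltNge.
  apply: (@lt_le_trans _ _ (lebesgue_measure `]0%R, 1%R])).
    by rewrite lebesgue_measure_itv /= lte_fin ltr01 -EFinB lte_fin; lra.
  apply: le_measure; rewrite ?inE //; first exact: bigcupT_measurable.
  move=> t; rewrite /= in_itv /= => t01; have /andP[t0 t1] := t01.
  have [B HB] := ptw _ _ lK0 t01.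
  exists (Num.bound `|B|) => //; split; first by rewrite /= in_itv /= ltW.
  move=> i _ /=; rewrite ler_pdivlMr ?exprn_gt0 // mulrC.
  apply: le_trans (HB i) _; apply: ltW.
  exact: le_lt_trans (ler_norm _) (archi_boundP (normr_ge0 _)).
exists (expR 1 * n%:R) => i t t01.
have EB s : E n s -> N (q i s) <= n%:R / (l * K) ^+ d i by case=> _ /(_ i Logic.I).
have E01 : E n `<=` `[0, 1] by move=> s [].
have := poly_fun_remez (qd i) (clE n) E01 muE EB t01; rewrite -/K.
move=> /(ler_wpM2l (ltW (exprn_gt0 (d i) l0))) /le_trans; apply.
rewrite [(l * K) ^+ _]exprMn invfM le_eqVlt; apply/orP; left; apply/eqP.
by field; rewrite !expf_neq0 // gt_eqF.
Qed.
End PolynomialFunctions.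

(** * From pointwise to uniform bounds in several variables *)

Section UniformOnBoxes.
Variables (R : realType) (F : fieldType) (emb : {rmorphism R -> F}).
Variables (V U : lmodType F) (N : U -> R).
Hypothesis N_triangle : forall x y, N (x + y) <= N x + N y.
Hypothesis N_scale : forall (t : R) x, N (emb t *: x) = `|t| * N x.

(** Combinations of [vs] with real coefficients in [[-T, T]]. *)
Fixpoint box (T : R) (vs : seq V) (y : V) : Prop :=
  if vs is v :: vs' then
    exists t z, [/\ `|t| <= T, box T vs' z & y = emb t *: v + z]
  else y = 0.

Lemma box_cat T vs ws y z : box T vs y -> box T ws z -> box T (vs ++ ws) (y + z).
Proof.
elim: vs y => [|v vs IH] y /=; first by move=> -> wz; rewrite add0r.
move=> [t [y' [tT vy' ->]]] wz; exists t, (y' + z); split=> //; first exact: IH.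
by rewrite addrA.
Qed.

(** One direction at a time: the point reached along the first direction, a real
    parameter, becomes part of the index of the family, so that no coefficients
    of polynomials in several variables are ever needed. *)
Lemma pointwise_uniform_box (T : R) (vs : seq V) : 0 <= T ->
  forall (I : Type) (d : I -> nat) (Q : I -> V -> U),
  (forall i x v, poly_fun emb (d i) (fun t => Q i (x + emb t *: v))) ->
  (forall (l : R) x, 0 < l -> exists B, forall i, l ^+ d i * N (Q i x) <= B) ->
  forall (l : R) x, 0 < l ->
    exists B, forall i y, box T vs y -> l ^+ d i * N (Q i (x + y)) <= B.
Proof.
move=> T0; elim: vs => [|v vs IH] I d Q Qpoly Qptw l x l0.
  have [B HB] := Qptw l x l0; exists B => i y /= ->.
  by rewrite addr0.
pose I' : Type := (I * {t : R | `|t| <= T})%type.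
pose Q' (i : I') y := Q i.1 (y + emb (sval i.2) *: v).
have [|{}l {}x {}l0|B HB] := IH I' (fun i => d i.1) Q' _ _ l x l0.
- move=> [i t] y w; have [a aE] := Qpoly i (y + emb (sval t) *: v) w.
  by exists a => s; rewrite -aE /Q' /= addrAC.
(* The parameter [s] in the unit segment stands for [t = 2 T s - T]. *)
- pose q i (s : R) := Q i (x - emb T *: v + emb s *: (emb (2 * T) *: v)).
  have [|l' t l'0 t01|B HB] := @pointwise_uniform _ _ emb _ N N_triangle N_scale
      I d q _ _ l l0.
  + by move=> i; exact: Qpoly.
  + exact: Qptw.
  exists B => -[i [t tT]]; rewrite /Q' /=.
  have [T_eq0|T_neq0] := eqVneq T 0.
    move: tT; rewrite T_eq0 normr_le0 => /eqP ->; rewrite rmorph0 scale0r addr0.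
    have := HB i 0; rewrite /q T_eq0 mulr0 rmorph0 !scale0r subr0 addr0.
    by apply; rewrite lexx ler01.
  have T_gt0 : 0 < T by rewrite lt_def T_neq0.
  have := HB i ((t + T) / (2 * T)).
  have -> : q i ((t + T) / (2 * T)) = Q i (x + emb t *: v).
    rewrite /q scalerA -rmorphM divfK ?mulf_neq0 // rmorphD scalerDl.
    by rewrite addrACA addNr addr0.
  apply; move: tT; rewrite ler_norml => /andP[tT Tt].
  rewrite divr_ge0 ?mulr_ge0 //=; last by lra.
  by rewrite ler_pdivrMr ?mulr_gt0 //; lra.
exists B => i y /= [t [z [tT vz ->]]].
have := HB (i, exist _ t tT) z vz; rewrite /Q' /=.
by rewrite -addrA [z + _]addrC.
Qed.
End UniformOnBoxes.

(** * Norms on real and complex spaces *)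

Section RealScalars.
Variable R : realType.

(** The embedding of the reals in the scalars.  Polynomials are studied along
    real lines even over the complex numbers, which treats both fields at once. *)
Definition real_scalar (k : base_field) : R -> scalar_field R k :=
  match k with
  | RealField => fun t : R => t
  | ComplexField => fun t : R => (t%:C)%C
  end.

Lemma real_scalar_zmod_morphism k : zmod_morphism (real_scalar k).
Proof. by case: k => t s //=; rewrite rmorphB. Qed.

Lemma real_scalar_monoid_morphism k : monoid_morphism (real_scalar k).
Proof. by case: k; split=> //= t s; rewrite rmorphM. Qed.

HB.instance Definition _ k := GRing.isZmodMorphism.Build R (scalar_field R k)
  (real_scalar k) (real_scalar_zmod_morphism k).
HB.instance Definition _ k := GRing.isMonoidMorphism.Build R (scalar_field R k)
  (real_scalar k) (real_scalar_monoid_morphism k).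

Lemma to_complex_zmod_morphism k : zmod_morphism (@to_complex R k).
Proof. by case: k => t s //=; rewrite rmorphB. Qed.

Lemma to_complex_monoid_morphism k : monoid_morphism (@to_complex R k).
Proof. by case: k; split=> //= t s; rewrite rmorphM. Qed.

HB.instance Definition _ k := GRing.isZmodMorphism.Build (scalar_field R k) R[i]%C
  (@to_complex R k) (@to_complex_zmod_morphism k).
HB.instance Definition _ k := GRing.isMonoidMorphism.Build (scalar_field R k) R[i]%C
  (@to_complex R k) (@to_complex_monoid_morphism k).

Lemma cmod_ge0 (z : R[i]%C) : 0 <= cmod z.
Proof. by rewrite /cmod normc_def sqrtr_ge0. Qed.

Lemma cmod_real (t : R) : cmod (t%:C)%C = `|t|.
Proof. by rewrite /cmod normc_def /= expr0n addr0 sqrtr_sqr. Qed.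

Lemma cmod_real_scalar k (t : R) : cmod (to_complex (real_scalar k t)) = `|t|.
Proof. by case: k; exact: cmod_real. Qed.

Lemma ler_Re_cmod (z : R[i]%C) : `|complex.Re z| <= cmod z.
Proof.
by rewrite /cmod normc_def /= -sqrtr_sqr ler_wsqrtr // lerDl sqr_ge0.
Qed.

Lemma ler_Im_cmod (z : R[i]%C) : `|complex.Im z| <= cmod z.
Proof.
by rewrite /cmod normc_def /= -sqrtr_sqr ler_wsqrtr // lerDr sqr_ge0.
Qed.

Lemma cmod_le_ReIm (z : R[i]%C) : cmod z <= `|complex.Re z| + `|complex.Im z|.
Proof.
rewrite /cmod normc_def /= -[leRHS]ger0_norm ?addr_ge0 // -sqrtr_sqr.
rewrite ler_wsqrtr // sqrrD !real_normK ?num_real //.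
by rewrite addrAC lerDl mulrn_wge0 // mulr_ge0.
Qed.

Lemma cmod0_eq (z : R[i]%C) : cmod z = 0 -> z = 0.
Proof.
move=> z0; apply/eqP; rewrite eq_complex -!normr_le0 /= -z0.
by rewrite ler_Re_cmod ler_Im_cmod.
Qed.
End RealScalars.

Section Norms.
Variables (R : realType) (k : base_field).
Local Notation F := (scalar_field R k).
Local Notation emb := (@real_scalar R k).

Lemma norm_real_scale (V : lmodType F) (nrm : V -> R) : is_norm nrm ->
  forall (t : R) x, nrm (emb t *: x) = `|t| * nrm x.
Proof. by move=> nV t x; rewrite norm_scale // cmod_real_scalar. Qed.

Lemma norm_ge0 (V : lmodType F) (nrm : V -> R) : is_norm nrm -> forall x, 0 <= nrm x.
Proof. by move=> nV; exact: seminorm_ge0 (norm_triangle nV) (norm_real_scale nV). Qed.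

Lemma norm_0 (V : lmodType F) (nrm : V -> R) : is_norm nrm -> nrm 0 = 0.
Proof. by move=> nV; exact: seminorm0 (norm_real_scale nV). Qed.

Lemma sum_norm_is_norm (V : lmodType F) (nrm : V -> R) m : is_norm nrm ->
  @is_norm R k {ffun 'I_m -> V} (sum_norm nrm (m := m)).
Proof.
move=> nV; split=> [X Y|a X|X].
- rewrite /sum_norm -big_split; apply: ler_sum => i _; rewrite ffunE.
  exact: norm_triangle.
- rewrite /sum_norm mulr_sumr; apply: eq_bigr => i _; rewrite ffunE.
  exact: norm_scale.
- rewrite /sum_norm => /eqP; rewrite psumr_eq0 => [/allP X0|i _]; last exact: norm_ge0.
  apply/ffunP => i; rewrite ffunE; apply: (norm_definite nV); apply/eqP.
  by apply: X0; rewrite mem_index_enum.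
Qed.

Variables (V : vectType F) (nrm : V -> R).
Hypothesis nV : is_norm nrm.

(** Equivalence of norms: the norm is continuous and positive on the unit sphere
    of the coordinates, which is compact. *)
Lemma real_free_coercive m (v : 'I_m -> V) :
  (forall t : 'rV[R]_m, \sum_j emb (t 0 j) *: v j = 0 -> t = 0) ->
  exists2 C, 0 <= C & forall t : 'rV[R]_m,
    `|t| <= C * nrm (\sum_j emb (t 0 j) *: v j).
Proof.
move=> v_free; pose phi (t : 'rV[R]_m) := nrm (\sum_j emb (t 0 j) *: v j).
have phiZ (s : R) t : phi (s *: t) = `|s| * phi t.
  rewrite /phi -norm_real_scale // scaler_sumr; congr nrm.
  by apply: eq_bigr => j _; rewrite mxE rmorphM scalerA.
case: m => [|m] in v v_free phi phiZ *.
  by exists 0 => // t; rewrite [t]thinmx0 normr0 mul0r.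
have phi_cont : continuous phi.
  move=> t; apply: (@cvg_norm_lincomb _ _ emb _ _ (norm_triangle nV)
    (norm_real_scale nV) _ (nbhs t) _ (fun j s => s 0 j) (fun j => t 0 j)).
  by move=> j; exact: (@coord_continuous R 1 m.+1 0 j t).
pose S := [set t : 'rV[R]_m.+1 | `|t| = 1].
have unit_norm (w : 'rV[R]_m.+1) : w != 0 -> `| `|w|^-1 *: w| = 1.
  by move=> w0; rewrite normrZ normfV normr_id mulVf // normr_eq0.
have S0 : S !=set0.
  exists (`|const_mx 1 : 'rV[R]_m.+1|^-1 *: const_mx 1); apply: unit_norm.
  by apply/eqP => /rowP/(_ 0); rewrite !mxE => /eqP; rewrite oner_eq0.
have compS : compact S.
  apply: bounded_closed_compact.
    by exists 1; split=> // M M1 t St; rewrite /= St ltW.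
  have /continuous_closedP := @norm_continuous R 'rV[R]_m.+1.
  by move=> /(_ [set 1] (@closed_eq _ 1)).
have [t0 /set_mem St0 phi_min] :=
  EVT_min_rV S0 compS (continuous_subspaceT phi_cont).
have phi_gt0 : 0 < phi t0.
  rewrite lt_def norm_ge0 // andbT; apply/eqP => /(norm_definite nV)/v_free t00.
  by move: St0; rewrite /S /= t00 normr0 => /eqP; rewrite eq_sym oner_eq0.
exists (phi t0)^-1 => [|t]; first by rewrite invr_ge0 ltW.
have [->|t_neq0] := eqVneq t 0; first by rewrite normr0 mulr_ge0 ?invr_ge0 ?norm_ge0.
have /mem_set/phi_min := unit_norm _ t_neq0; rewrite phiZ normfV normr_id.
rewrite ler_pdivlMl ?normr_gt0 // mulrC => le_t.
by rewrite ler_pdivlMl // mulrC.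
Qed.
End Norms.

Section CoordinateBounds.
Variable R : realType.

Lemma ler_coord_norm m (t : 'rV[R]_m) j : `|t 0 j| <= `|t|.
Proof.
rewrite [leRHS]/Num.norm /= mx_normrE; apply/bigmax_geP; right.
by exists (0, j).
Qed.

Lemma coord_bounded_real (V : vectType (scalar_field R RealField)) (nrm : V -> R) :
  is_norm nrm -> exists2 C, 0 <= C & forall x i,
  cmod (to_complex (coord (vbasis {:V}) i x)) <= C * nrm x.
Proof.
move=> nV; set e := vbasis {:V}.
have e_free : free e := basis_free (vbasisP {:V}).
have [t et0|C C0 HC] := @real_free_coercive _ _ _ _ nV _ (fun i : 'I_(\dim {:V}) => e`_i).
  apply/rowP => j; rewrite mxE.
  by have /freeP/(_ (fun j => t 0 j) et0 j) := e_free.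
exists C => // x i; rewrite cmod_real.
have := HC (\row_i coord e i x).
have -> : \sum_j real_scalar RealField ((\row_i coord e i x) 0 j) *: e`_j = x.
  rewrite [RHS](coord_vbasis (memvf x)); apply: eq_bigr => j _.
  by rewrite mxE.
apply: le_trans; have := ler_coord_norm (\row_i coord e i x) i.
by rewrite mxE.
Qed.

(** Over the reals, a basis is formed by the [e_j] together with the [i e_j]. *)
Lemma coord_bounded_complex (V : vectType (scalar_field R ComplexField)) (nrm : V -> R) :
  is_norm nrm -> exists2 C, 0 <= C & forall x i,
  cmod (to_complex (coord (vbasis {:V}) i x)) <= C * nrm x.
Proof.
move=> nV; set e := vbasis {:V}; set d := \dim {:V} in e *.
have e_free : free e := basis_free (vbasisP {:V}).
pose v (i : 'I_(d + d)) : V :=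
  match fintype.split i with inl j => e`_j | inr j => ('i%C : R[i]%C) *: e`_j end.
have vE (t : 'rV[R]_(d + d)) :
    \sum_j real_scalar ComplexField (t 0 j) *: v j =
    \sum_(j < d) ((t 0 (lshift d j) +i* t 0 (rshift d j))%C : R[i]%C) *: e`_j.
  rewrite big_split_ord /= -big_split; apply: eq_bigr => j _.
  rewrite /v !(unsplitK (inl _)) !(unsplitK (inr _)) /= scalerA -scalerDl; congr (_ *: _).
  by apply/eqP; rewrite eq_complex /=; apply/andP; split; apply/eqP; ring.
have [t|C C0 HC] := @real_free_coercive _ _ _ _ nV _ v.
  rewrite vE => et0; have /freeP/(_ _ et0) t0 := e_free.
  apply/rowP => j; rewrite mxE -[j]splitK.
  by case: (fintype.split j) => i /=; have [] := t0 i.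
exists (C + C) => [|x i]; first exact: addr_ge0.
pose t : 'rV[R]_(d + d) := row_mx (\row_j complex.Re (coord e j x : R[i]%C))
                                 (\row_j complex.Im (coord e j x : R[i]%C)).
have := HC t; rewrite vE.
have -> : \sum_(j < d) ((t 0 (lshift d j) +i* t 0 (rshift d j))%C : R[i]%C) *: e`_j = x.
  rewrite [RHS](coord_vbasis (memvf x)); apply: eq_bigr => j _.
  by rewrite row_mxEl row_mxEr !mxE; case: (coord _ j x).
move=> tC; apply: le_trans (cmod_le_ReIm _) _; rewrite mulrDl; apply: lerD.
  apply: le_trans tC; have := ler_coord_norm t (lshift d i).
  by rewrite row_mxEl mxE.
apply: le_trans tC; have := ler_coord_norm t (rshift d i).
by rewrite row_mxEr mxE.
Qed.

Lemma coord_bounded k (V : vectType (scalar_field R k)) (nrm : V -> R) :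
  is_norm nrm -> exists2 C, 0 <= C & forall x i,
  cmod (to_complex (coord (vbasis {:V}) i x)) <= C * nrm x.
Proof.
by case: k V nrm => V nrm; [exact: coord_bounded_real|exact: coord_bounded_complex].
Qed.

Lemma linear_bounded k (V U : vectType (scalar_field R k)) (nV : V -> R) (nU : U -> R)
    (L : 'Hom(V, U)) : is_norm nV -> is_norm nU ->
  exists2 C, 0 <= C & forall x, nU (L x) <= C * nV x.
Proof.
move=> normV normU; have [C C0 HC] := coord_bounded normV.
exists (\sum_(i < \dim {:V}) C * nU (L (vbasis {:V})`_i)) => [|x].
  by apply: sumr_ge0 => i _; rewrite mulr_ge0 // norm_ge0.
rewrite [X in L X](coord_vbasis (memvf x)) linear_sum mulr_suml.
apply: le_trans (ler_seminorm_sum (norm_triangle normU) (norm_real_scale normU) _ _ _) _.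
apply: ler_sum => i _; rewrite linearZ norm_scale // mulrAC.
by rewrite ler_wpM2r ?norm_ge0.
Qed.

(** A projection that vanishes exactly on [H] is bounded, hence continuous. *)
Lemma subspace_closed k (V : vectType (scalar_field R k)) (nV : V -> R) (H : {vspace V})
    (u : nat -> V) (x : V) : is_norm nV -> (forall n, u n \in H) ->
  nV (u n - x) @[n --> \oo] --> (0 : R) -> x \in H.
Proof.
move=> normV uH ux; pose L := (\1 - projv H)%VF.
have LH y : y \in H -> L y = 0.
  by move=> yH; rewrite /L lfunE /= opp_lfunE id_lfunE projv_id // subrr.
have [C C0 HC] := linear_bounded L normV normV.
have Lx0 : L x = 0.
  apply: (norm_definite normV); apply/eqP; rewrite eq_le norm_ge0 // andbT.
  have CU : C * nV (u n - x) @[n --> \oo] --> (0 : R).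
    by rewrite -(mulr0 C); apply: cvgMr.
  rewrite -(cvg_lim _ CU) //; apply: limr_ge; first exact: cvgP CU.
  apply: nearW => n.
  have -> : L x = - L (u n - x) by rewrite raddfB /= (LH _ (uH n)) sub0r opprK.
  by rewrite (seminormN (norm_real_scale normV)).
have -> : x = projv H x.
  by apply/eqP; rewrite -subr_eq0 -Lx0 /L lfunE /= opp_lfunE id_lfunE.
exact: memv_proj.
Qed.
End CoordinateBounds.

(** * Uniform and linear bounds on balls *)

Section UniformOnBalls.
Variables (R : realType) (k : base_field).
Local Notation F := (scalar_field R k).
Local Notation emb := (@real_scalar R k).

(** A real basis of the line spanned by [v] (when [v] is nonzero). *)
Definition real_multiples : forall (V : lmodType F), V -> seq V :=
  match k return forall (V : lmodType (scalar_field R k)), V -> seq V with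
  | RealField => fun V v => [:: v]
  | ComplexField => fun V v => [:: v; ('i%C : R[i]%C) *: v]
  end.

Lemma real_multiples_box (V : lmodType F) (v : V) (z : F) T :
  cmod (to_complex z) <= T -> box emb T (real_multiples v) (z *: v).
Proof.
rewrite /real_multiples; case: k V v z => V v z /= zT.
  exists z, 0; split=> //; last by rewrite addr0.
  by move: zT; rewrite cmod_real.
exists (complex.Re z), (((complex.Im z)%:C)%C *: (('i%C : R[i]%C) *: v)).
split; first exact: le_trans (ler_Re_cmod z) zT.
  exists (complex.Im z), 0; split=> //; last by rewrite addr0.
  exact: le_trans (ler_Im_cmod z) zT.
by rewrite scalerA -scalerDl [in LHS](complexE z) ['i%C * _]mulrC.
Qed.

Variables (V : vectType F) (nV : V -> R).
Hypothesis normV : is_norm nV.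

Lemma ball_in_box M : 0 <= M -> exists2 T, 0 <= T & exists vs : seq V,
  forall x, nV x <= M -> box emb T vs x.
Proof.
move=> M0; have [C C0 HC] := coord_bounded normV.
exists (C * M); first exact: mulr_ge0.
exists (flatten [seq real_multiples (vbasis {:V})`_i | i : 'I_(\dim {:V}) <- index_enum _]).
move=> x xM; rewrite (coord_vbasis (memvf x)).
elim: (index_enum _) => [|i s IH]; first by rewrite big_nil.
rewrite big_cons; apply: box_cat => //; apply: real_multiples_box.
by apply: le_trans (HC _ _) _; rewrite ler_wpM2l.
Qed.

Variables (U : lmodType F) (nU : U -> R).
Hypothesis normU : is_norm nU.
Variables (I : Type) (d : I -> nat) (Q : I -> V -> U).
Hypothesis Q_poly : forall i x v, poly_fun emb (d i) (fun t => Q i (x + emb t *: v)).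
Hypothesis Q_ptw :
  forall (l : R) x, 0 < l -> exists B, forall i, l ^+ d i * nU (Q i x) <= B.

Lemma pointwise_uniform_ball M (l : R) : 0 <= M -> 0 < l ->
  exists B, forall i x, nV x <= M -> l ^+ d i * nU (Q i x) <= B.
Proof.
move=> M0 l0; have [T T0 [vs Hvs]] := ball_in_box M0.
have [B HB] := pointwise_uniform_box (norm_triangle normU) (norm_real_scale normU)
  vs T0 Q_poly Q_ptw 0 l0.
by exists B => i x /Hvs /(HB i); rewrite add0r.
Qed.

Hypothesis Q_0 : forall i, Q i 0 = 0.

(** Since [Q i] vanishes at [0], on the line through [y] the polynomial
    [Q i (s y)] is [s] times a polynomial in [s].  The one-variable principle
    applies to the family of these quotients, indexed by [i] and by [y] in a
    ball: away from [s = 0] they are bounded because [Q i] is, and the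
    conclusion at [s = |x| / |y|] is a bound linear in [|x|]. *)
Lemma pointwise_uniform_linear M (l : R) : 0 <= M -> 0 < l ->
  exists2 B, 0 <= B & forall i x, nV x <= M -> l ^+ d i * nU (Q i x) <= B * nV x.
Proof.
move=> M0 l0.
(* Nonzero vectors are rescaled to a sphere, which needs a positive radius. *)
pose M' := M + 1.
have M'0 : 0 < M' by rewrite /M'; lra.
(* The coefficients of the quotient are carried by the index. *)
pose quot_spec (p : I * V * (nat -> U)) := nV p.1.2 <= M' /\ forall s,
  Q p.1.1 (emb s *: p.1.2) =
  emb s *: \sum_(j < (d p.1.1).+1) emb (s ^+ j) *: p.2 j.
pose J : Type := {p | quot_spec p}.
pose q (p : J) (s : R) :=
  \sum_(j < (d (sval p).1.1).+1) emb (s ^+ j) *: (sval p).2 j.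
have qd (p : J) : poly_fun emb (d (sval p).1.1) (q p) by exists (sval p).2.
have q_ptw (l' s : R) : 0 < l' -> 0 < s <= 1 ->
    exists B, forall p : J, l' ^+ d (sval p).1.1 * nU (q p s) <= B.
  move=> l'0 /andP[s0 s1].
  have [B HB] := pointwise_uniform_ball (ltW M'0) l'0.
  exists (s^-1 * B) => -[[[i y] a] [/= yM aE]]; rewrite /q /=.
  have := HB i (emb s *: y); rewrite aE !norm_real_scale // gtr0_norm //.
  rewrite mulrCA ler_pdivlMl //; apply.
  by apply: le_trans yM; rewrite ler_piMl ?norm_ge0.
have [B HB] := pointwise_uniform (norm_triangle normU) (norm_real_scale normU)
  qd q_ptw l0.
have B'0 : 0 <= Num.max B 0 by rewrite le_max lexx orbT.
(* [Num.max] only ensures that the constant is nonnegative when the family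
   is empty. *)
exists (Num.max B 0 / M') => [|i x xM]; first by rewrite divr_ge0 // ltW.
have [->|x_neq0] := eqVneq x 0.
  by rewrite Q_0 !norm_0 // !mulr0.
have nx0 : 0 < nV x.
  by rewrite lt_def norm_ge0 // andbT; apply: contra x_neq0 => /eqP /(norm_definite normV) ->.
pose y := emb (M' / nV x) *: x; pose s := nV x / M'.
have yM : nV y <= M'.
  by rewrite norm_real_scale // gtr0_norm ?divr_gt0 // divfK // gt_eqF.
have xE : x = emb s *: y.
  rewrite /y scalerA -rmorphM (_ : s * _ = 1) ?rmorph1 ?scale1r //.
  by rewrite /s; field; rewrite !gt_eqF.
have s01 : 0 <= s <= 1.
  rewrite divr_ge0 ?(ltW nx0) ?(ltW M'0) //= ler_pdivrMr // mul1r.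
  by apply: le_trans xM _; rewrite /M'; lra.
have [a aE] := Q_poly i 0 y.
have a0 : a 0%N = 0.
  have := aE 0; rewrite rmorph0 scale0r addr0 Q_0 big_ord_recl expr0 rmorph1 scale1r.
  by rewrite big1 ?addr0 // => j _; rewrite expr0n rmorph0 scale0r.
pose b j := if (j < d i)%N then a j.+1 else 0.
have spec : quot_spec (i, y, b).
  split=> //= t; have := aE t; rewrite add0r => ->.
  rewrite big_ord_recl a0 scaler0 add0r big_ord_recr /= {2}/b ltnn scaler0 addr0.
  rewrite scaler_sumr; apply: eq_bigr => j _.
  by rewrite /b ltn_ord scalerA -rmorphM -exprS.
have := HB (exist _ _ spec) s s01; rewrite /q /=.
have := spec.2 s; rewrite /= -xE => ->.
rewrite norm_real_scale //; case/andP: s01 => s0 _; rewrite ger0_norm // => le_B.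
rewrite mulrCA [leRHS](_ : _ = s * Num.max B 0); last by rewrite /s; ring.
by rewrite ler_wpM2l // (le_trans le_B) // le_max lexx.
Qed.
End UniformOnBalls.

(** * Lie words and the growth of a Lie function *)

Section LieBracket.
Variables (K : fieldType) (g : lieAlgebraType K).
Implicit Types x y z : g.

Lemma lieDl x y z : lie (x + y) z = lie x z + lie y z.
Proof. by have := lie_linearl 1 x y z; rewrite !scale1r. Qed.

Lemma lieDr x y z : lie z (x + y) = lie z x + lie z y.
Proof. by have := lie_linearr 1 x y z; rewrite !scale1r. Qed.

Lemma lie0l z : lie 0 z = 0.
Proof. by apply: (addrI (lie 0 z)); rewrite -lieDl !addr0. Qed.

Lemma lie0r z : lie z 0 = 0.
Proof. by apply: (addrI (lie z 0)); rewrite -lieDr !addr0. Qed.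

Lemma lieZl a x z : lie (a *: x) z = a *: lie x z.
Proof. by have := lie_linearl a x 0 z; rewrite addr0 lie0l addr0. Qed.

Lemma lieZr a x z : lie z (a *: x) = a *: lie z x.
Proof. by have := lie_linearr a x 0 z; rewrite addr0 lie0r addr0. Qed.

Lemma lie_suml (I : Type) (s : seq I) (G : I -> g) z :
  lie (\sum_(i <- s) G i) z = \sum_(i <- s) lie (G i) z.
Proof. by apply: (big_morph (lie^~ z)) => [x y|]; rewrite ?lieDl ?lie0l. Qed.

Lemma lie_sumr (I : Type) (s : seq I) (G : I -> g) z :
  lie z (\sum_(i <- s) G i) = \sum_(i <- s) lie z (G i).
Proof. by apply: (big_morph (lie z)) => [x y|]; rewrite ?lieDr ?lie0r. Qed.

Lemma lieC x y : lie x y = - lie y x.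
Proof.
apply/eqP; rewrite -addr_eq0; have := lie_alternating (x + y).
by rewrite lieDl !lieDr !lie_alternating add0r addr0 => ->.
Qed.
End LieBracket.

Section PolynomialFunctionClosure.
Variables (R : realType) (F : fieldType) (emb : {rmorphism R -> F}).

Lemma poly_fun_sum (U : lmodType F) m (I : Type) (s : seq I) (P : pred I)
    (q : I -> R -> U) : (forall i, P i -> poly_fun emb m (q i)) ->
  poly_fun emb m (fun t => \sum_(i <- s | P i) q i t).
Proof.
move=> qm; elim: s => [|i s [a aE]].
  exists (fun=> 0) => t; rewrite big_nil big1 // => j _; exact: scaler0.
have [Pi|nPi] := boolP (P i); last first.
  by exists a => t; rewrite big_cons (negPf nPi) aE.
have [b bE] := qm i Pi; exists (fun j => b j + a j) => t.
rewrite big_cons Pi aE bE -big_split; apply: eq_bigr => j _.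
by rewrite scalerDr.
Qed.

Lemma poly_fun_lie (g : lieAlgebraType F) (y z : g) m q :
  poly_fun emb m q -> poly_fun emb m.+1 (fun t => lie (y + emb t *: z) (q t)).
Proof.
move=> [a qE].
exists (fun j => (if (j <= m)%N then lie y (a j) else 0) +
                 (if j is i.+1 then lie z (a i) else 0)) => t.
under [RHS]eq_bigr do rewrite scalerDr.
rewrite big_split big_ord_recr [X in _ = _ + X]big_ord_recl /=.
rewrite ltnn !scaler0 addr0 add0r qE lieDl !lie_sumr; congr (_ + _).
  by apply: eq_bigr => j _; rewrite lieZr -ltnS ltn_ord.
by apply: eq_bigr => j _; rewrite lieZr lieZl scalerA exprSr rmorphM.
Qed.
End PolynomialFunctionClosure.

Section Words.
Variables (R : realType) (k : base_field).
Local Notation F := (scalar_field R k).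
Local Notation emb := (@real_scalar R k).
Variables (g : lieAlgebraType F) (n r : nat).
Implicit Types (X V : {ffun 'I_n -> g}) (W : {ffun 'I_r -> g}) (w : seq (letter n r)).

Lemma nested_bracket_scale a X W l w :
  nested_bracket (a *: X) (a *: W) l w = a ^+ (size w).+1 *: nested_bracket X W l w.
Proof.
have letterE l' : eval_letter (a *: X) (a *: W) l' = a *: eval_letter X W l'.
  by case: l' => j /=; rewrite ffunE.
elim: w l => [|l' w IH] l /=; first by rewrite letterE expr1.
by rewrite letterE IH lieZl lieZr scalerA -exprS.
Qed.

Lemma nested_bracket_state0 W l w : has (@is_state_letter n r) (l :: w) ->
  nested_bracket 0 W l w = 0.
Proof.
elim: w l => [|l' w IH] [j|j] //=; rewrite ?ffunE ?lie0l //.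
by move=> /IH ->; rewrite lie0r.
Qed.

Lemma nested_bracket_poly_fun X V W l w :
  poly_fun emb (size w).+1 (fun t => nested_bracket (X + emb t *: V) W l w).
Proof.
have letterE t l' : eval_letter (X + emb t *: V) W l' =
    eval_letter X W l' + emb t *: eval_letter V 0 l'.
  by case: l' => j /=; rewrite !ffunE // scaler0 addr0.
elim: w l => [|l' w IH] l /=.
  exists (fun j => if j is 0%N then eval_letter X W l else eval_letter V 0 l) => t.
  by rewrite letterE big_ord_recl big_ord1 expr0 rmorph1 scale1r.
have [a aE] := poly_fun_lie (eval_letter X W l) (eval_letter V 0 l) (IH l').
by exists a => t; rewrite -aE letterE.
Qed.

Variable c : seq (letter n r) -> 'I_n -> F.
Local Notation P m := (words_of_length c m.+2).

Lemma words_of_length_scale a m X W : P m (a *: X) (a *: W) = a ^+ m.+2 *: P m X W.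
Proof.
rewrite /words_of_length scaler_sumr; apply: eq_bigr => w _.
apply/ffunP => i; rewrite !ffunE; case/tupleP: w => l w /=.
by rewrite nested_bracket_scale size_tuple scalerA mulrC -scalerA.
Qed.

Lemma words_of_length_state0 m W : P m 0 W = 0.
Proof.
rewrite /words_of_length big1 // => w; case/tupleP: w => l w w_state.
by apply/ffunP => i; rewrite !ffunE /= nested_bracket_state0 // scaler0.
Qed.

Lemma words_of_length_poly_fun m X V W :
  poly_fun emb m.+2 (fun t => P m (X + emb t *: V) W).
Proof.
apply: poly_fun_sum => w _; case/tupleP: w => l w /=.
have [a aE] := nested_bracket_poly_fun X V W l w.
exists (fun j => [ffun i => c (l :: w) i *: a j]) => t.
apply/ffunP => i; rewrite ffunE aE size_tuple sum_ffunE scaler_sumr.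
by apply: eq_bigr => j _; rewrite !ffunE !scalerA mulrC.
Qed.
End Words.

Section LinearGrowth.
Variables (R : realType) (k : base_field).
Local Notation F := (scalar_field R k).
Variables (g : lieAlgebraType F) (nrm : g -> R) (n r : nat).
Variables (A : 'End({ffun 'I_n -> g})).
Variable f : {ffun 'I_n -> g} -> {ffun 'I_r -> g} -> {ffun 'I_n -> g}.
Hypothesis hnrm : is_norm nrm.
Local Notation nX := (@sum_norm R g nrm n).

Lemma sum_half_powers N : \sum_(2 <= m < N) 2 ^- m <= 1 :> R.
Proof.
have E p : \sum_(2 <= m < p.+2) 2 ^- m = 1 / 2 - 2 ^- p.+1 :> R.
  elim: p => [|p IH]; first by rewrite big_geq // expr1; lra.
  rewrite big_nat_recr //= IH.
  have -> : 2 ^- p.+2 = 2^-1 * 2 ^- p.+1 :> R by rewrite exprS invfM.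
  lra.
case: N => [|[|N]]; [by rewrite big_geq|by rewrite big_geq|rewrite E].
have : 0 < 2 ^- N.+1 :> R by rewrite invr_gt0 exprn_gt0.
lra.
Qed.

(** The sum of the words of length [m] is homogeneous of degree [m] in the state
    and the signal together, so the convergence of the series at
    [(l X, l W)], for every [l], bounds [l ^ m] times its value at [(X, W)].
    This pointwise information becomes a uniform bound, linear in [X], and
    the series is then dominated by a geometric one. *)
Lemma lie_function_linear_growth (hf : lie_function_with_linear_part nrm A f) W M :
  0 <= M -> exists2 C, 0 <= C & forall X, nX X <= M -> nX (f X W) <= C * nX X.
Proof.
move=> M0; have [c cvf] := hf; have hX := sum_norm_is_norm n hnrm.
have tri := norm_triangle hX.
pose S X W' N := A X + \sum_(2 <= m < N) words_of_length c m X W' - f X W'.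
have ptw (l : R) X : 0 < l ->
    exists B, forall i, l ^+ i.+2 * nX (words_of_length c i.+2 X W) <= B.
  move=> l0; pose a := real_scalar k l.
  have /cvgP/cvg_seq_bounded [B [_ HB]] := cvf (a *: X) (a *: W).
  have {}HB N : nX (S (a *: X) (a *: W) N) <= B + 1.
    have := HB (B + 1); rewrite ltrDl ltr01 => /(_ isT N Logic.I).
    by apply: le_trans; exact: ler_norm.
  exists ((B + 1) + (B + 1)) => i.
  rewrite -[l ^+ _]gtr0_norm ?exprn_gt0 // -(norm_real_scale hX).
  rewrite rmorphXn -words_of_length_scale -/a.
  have -> : words_of_length c i.+2 (a *: X) (a *: W) =
      S (a *: X) (a *: W) i.+3 + - S (a *: X) (a *: W) i.+2.
    by rewrite /S big_nat_recr //= opprB !addrA subrK addrAC subrr add0r.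
  apply: le_trans (tri _ _) _; apply: lerD => //.
  by rewrite (seminormN (norm_real_scale hX)).
have [B B0 HB] := @pointwise_uniform_linear R k _ _ hX _ _ hX nat (fun i => i.+2)
  (fun i X => words_of_length c i.+2 X W)
  (fun i X V => words_of_length_poly_fun c i X V W) ptw
  (fun i => words_of_length_state0 c i W) M 2 M0 (ltr0n _ 2).
have [CA CA0 HA] := linear_bounded A hX hX.
exists (CA + B) => [|X XM]; first exact: addr_ge0.
have Sle N : nX (f X W) <= (CA + B) * nX X + nX (S X W N).
  have -> : f X W = A X + \sum_(2 <= m < N) words_of_length c m X W + - S X W N.
    by rewrite /S opprB addrC subrK.
  apply: le_trans (tri _ _) _; rewrite (seminormN (norm_real_scale hX)) lerD2r mulrDl.
  apply: le_trans (tri _ _) _; apply: lerD => //.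
  apply: le_trans (ler_seminorm_sum tri (norm_real_scale hX) _ _ _) _.
  apply: (@le_trans _ _ (\sum_(2 <= m < N) (2 ^- m * (B * nX X)))).
    rewrite !big_nat; apply: ler_sum => -[|[|m]] // _.
    by rewrite ler_pdivlMl ?exprn_gt0 //; exact: HB.
  by rewrite -mulr_suml ler_piMl ?mulr_ge0 ?norm_ge0 ?sum_half_powers.
have cvS : (CA + B) * nX X + nX (S X W N) @[N --> \oo] --> (CA + B) * nX X.
  rewrite -[X in _ --> X]addr0; apply: cvgD; first exact: cvg_cst.
  exact: cvf.
rewrite -(cvg_lim _ cvS) //; apply: limr_ge; first exact: cvgP cvS.
exact: nearW.
Qed.
End LinearGrowth.

(** * The lower central series and finite-time convergence *)

Section LowerCentralSeries.
Variables (K : fieldType) (g : lieAlgebraType K).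
Implicit Types (U V T h : {vspace g}) (x y z : g).

HB.instance Definition _ z := GRing.isLinear.Build K g g *:%R (lie z)
  (fun a x y => lie_linearr a x y z).

Lemma mem_lie_span U V x y : x \in U -> y \in V -> lie x y \in lie_span U V.
Proof.
move=> xU yV; rewrite (coord_vbasis xU) lie_suml memv_suml // => i _.
rewrite (coord_vbasis yV) lie_sumr memv_suml // => j _.
rewrite lieZl lieZr !memvZ // memv_span //.
by apply: allpairs_f; rewrite mem_nth // size_tuple.
Qed.

Lemma lie_span_subv U V T : (forall x y, x \in U -> y \in V -> lie x y \in T) ->
  (lie_span U V <= T)%VS.
Proof.
move=> UVT; apply/span_subvP => _ /allpairsP[[x y] /= [xU yV ->]].
by apply: UVT; exact: vbasis_mem.
Qed.

(** The Jacobi identity in the form that shows spans of brackets of ideals to be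
    ideals. *)
Lemma lie_derivation z x y : lie z (lie x y) = lie (lie z x) y + lie x (lie z y).
Proof.
apply/eqP; rewrite -subr_eq0 -(lie_jacobi z x y) (lieC y z) (lieC y (lie z x)).
by rewrite linearN opprD addrA addrAC.
Qed.

Lemma lie_span_ideal U V : is_ideal U -> is_ideal V -> is_ideal (lie_span U V).
Proof.
move=> idU idV z y yS; rewrite -(lfunE (lie z)) memv_preim; move: y yS.
apply/subvP; apply: lie_span_subv => u v uU vV.
rewrite -memv_preim lfunE /= lie_derivation.
by rewrite memvD // mem_lie_span //; [exact: idU|exact: idV].
Qed.

Lemma lower_central_ideal h i : is_ideal h -> is_ideal (lower_central h i).
Proof. by move=> idh; elim: i => [|i IH] //; exact: lie_span_ideal. Qed.

Lemma lower_central_decr h i : is_ideal h ->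
  (lower_central h i.+1 <= lower_central h i)%VS.
Proof.
move=> idh; apply: lie_span_subv => x y xL _; rewrite lieC memvN.
exact: lower_central_ideal.
Qed.

Lemma lower_central_sub h i : is_ideal h -> (lower_central h i <= h)%VS.
Proof.
move=> idh; elim: i => [|i IH]; first exact: subvv.
exact: subv_trans (lower_central_decr i idh) IH.
Qed.

(** The chain that starts at the whole algebra and continues with the lower
    central series of [h]: the passage from the algebra to [h] is then a step
    like the others. *)
Definition ideal_chain h (i : nat) : {vspace g} :=
  if i is j.+1 then lower_central h j else fullv.
End LowerCentralSeries.

Section Deadbeat.
Variables (R : realType) (k : base_field).
Local Notation F := (scalar_field R k).
Variables (g : lieAlgebraType F) (nrm : g -> R) (n r : nat).
Variables (A : 'End({ffun 'I_n -> g})).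
Variable f : {ffun 'I_n -> g} -> {ffun 'I_r -> g} -> {ffun 'I_n -> g}.
Variable h : {vspace g}.
Hypothesis hnrm : is_norm nrm.
Hypothesis hf : lie_function_with_linear_part nrm A f.
Hypothesis hideal : is_ideal h.
Hypothesis hder : (lie_span fullv fullv <= h)%VS.
Hypothesis hinv : preserves_lower_central h f.
Implicit Types (X Y : {ffun 'I_n -> g}) (W : {ffun 'I_r -> g}) (U : {vspace g}).
Local Notation L := (ideal_chain h).

Lemma nested_bracket_subspace U X W l w : in_power U X -> in_power U W ->
  is_ideal U -> nested_bracket X W l w \in U.
Proof.
move=> XU WU idU; elim: w l => [|l' w IH] [j|j] /=;
  by [exact: XU|exact: WU|exact: idU].
Qed.

Lemma nested_bracket_state_ideal U X W l w : in_power U X -> is_ideal U ->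
  has (@is_state_letter n r) (l :: w) -> nested_bracket X W l w \in U.
Proof.
move=> XU idU; elim: w l => [|l' w IH] [j|j] //=.
- by move=> _; rewrite lieC memvN; exact: idU.
- by move=> /IH; exact: idU.
Qed.

(** In the first step the word is a bracket, hence in the derived algebra.
    Later all letters are in [h], and the word is the bracket of an element of
    the current term with one of [h], in one order or the other. *)
Lemma word_ideal_chain i X W l l' w : in_power (L i) X -> in_power h W ->
  has (@is_state_letter n r) [:: l, l' & w] ->
  nested_bracket X W l (l' :: w) \in L i.+1.
Proof.
case: i => [|i] /= XL Wh w_state.
  apply: (subvP hder); apply: mem_lie_span; exact: memvf.
have Xh : in_power h X by move=> j; apply: (subvP (lower_central_sub i hideal)).
move: w_state; case: l => j /=.
  by move=> _; apply: mem_lie_span => //; exact: nested_bracket_subspace.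
move=> w_state; rewrite lieC memvN; apply: mem_lie_span => //.
by apply: nested_bracket_state_ideal => //; exact: lower_central_ideal.
Qed.

(** The difference is a limit of sums of words; subspaces are closed. *)
Lemma step_mod_ideal_chain i X W : in_power (L i) X -> in_power h W ->
  in_power (L i.+1) (f X W - A X).
Proof.
move=> XL Wh j; have [c /(_ X W) cvf] := hf.
pose S N : {ffun 'I_n -> g} := \sum_(2 <= m < N) words_of_length c m X W.
apply: (@subspace_closed _ _ _ _ _ (fun N => S N j) _ hnrm).
  move=> N; rewrite /S sum_ffunE big_nat memv_suml // => -[|[|m]] // _.
  rewrite /words_of_length sum_ffunE memv_suml // => w.
  case/tupleP: w => l w; case/tupleP: w => l' w w_state.
  by rewrite ffunE memvZ // word_ideal_chain.
apply: (squeeze_cvgr _ (cvg_cst 0) cvf).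
apply: nearW => N /=; rewrite norm_ge0 //=.
have -> : S N j - (f X W - A X) j = (A X + S N - f X W) j.
  by rewrite !ffunE opprB addrCA addrA.
rewrite /sum_norm (bigD1 j) //= lerDl.
by apply: sumr_ge0 => i' _; exact: norm_ge0.
Qed.

Lemma in_power0 m U : in_power U (0 : {ffun 'I_m -> g}).
Proof. by move=> i; rewrite ffunE mem0v. Qed.

Lemma in_powerD m U (X Y : {ffun 'I_m -> g}) :
  in_power U X -> in_power U Y -> in_power U (X + Y).
Proof. by move=> XU YU i; rewrite ffunE memvD. Qed.

Lemma in_powerN m U (X : {ffun 'I_m -> g}) : in_power U X -> in_power U (- X).
Proof. by move=> XU i; rewrite ffunE memvN. Qed.

Lemma ideal_chain_decr i : (L i.+1 <= L i)%VS.
Proof. by case: i => [|i]; [exact: subvf|exact: lower_central_decr]. Qed.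

Lemma f_ideal_chain i X W : in_power (L i) X -> in_power (L i) (f X W).
Proof. by case: i => [|i]; [move=> _ j; exact: memvf|exact: hinv]. Qed.

(** With zero signal, [A X] differs from [f X 0] by an element of the next term. *)
Lemma linear_part_ideal_chain i X : in_power (L i) X -> in_power (L i) (A X).
Proof.
move=> XL; have -> : A X = f X 0 - (f X 0 - A X) by rewrite opprB addrC subrK.
apply: in_powerD; first exact: f_ideal_chain.
apply: in_powerN => j; apply: (subvP (ideal_chain_decr i)).
by apply: step_mod_ideal_chain => //; exact: in_power0.
Qed.

Variables (W : nat -> {ffun 'I_r -> g}) (X : nat -> {ffun 'I_n -> g}).
Hypothesis hWh : forall t, in_power h (W t).
Hypothesis hX : is_trajectory f W X.

Lemma trajectory_mod_ideal_chain i t s : in_power (L i) (X t) ->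
  in_power (L i) (X (t + s)%N) /\
  in_power (L i.+1) (X (t + s)%N - iter s A (X t)).
Proof.
move=> XL; elim: s => [|s [IH1 IH2]].
  by rewrite addn0 subrr; split=> //; exact: in_power0.
rewrite addnS hX; split; first exact: f_ideal_chain.
rewrite /= -[f _ _](subrK (A (X (t + s)%N))) -addrA -raddfB.
apply: in_powerD; first exact: step_mod_ideal_chain.
exact: (@linear_part_ideal_chain i.+1).
Qed.

(** Modulo the next term of the chain a trajectory follows the nilpotent [A], so
    [d] steps move it into that term. *)
Lemma deadbeat d p : (forall Y, iter d A Y = 0) -> lower_central h p = 0%VS ->
  forall t, (p.+1 * d <= t)%N -> X t = 0.
Proof.
move=> A_nil h_nil t tp.
have XL i : in_power (L i) (X (i * d)%N).
  elim: i => [|i IH]; first by move=> j; exact: memvf.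
  have [_] := trajectory_mod_ideal_chain d IH.
  by rewrite A_nil subr0 mulSn addnC.
have [XtL _] := trajectory_mod_ideal_chain (t - p.+1 * d) (XL p.+1).
move: XtL; rewrite subnKC // /= h_nil => X0.
by apply/ffunP => j; rewrite ffunE; apply/eqP; rewrite -memv0.
Qed.
End Deadbeat.

(** * Nilpotency from the spectral radius *)

Section SpectralRadius.
Variables (R : realType) (k : base_field).
Local Notation F := (scalar_field R k).

(** The characteristic polynomial is a power of the variable: Cayley-Hamilton. *)
Lemma nilpotent_of_eigenvalue0 (C : closedFieldType) d (B : 'M[C]_d) :
  (forall mu, eigenvalue B mu -> mu = 0) ->
  forall u : 'rV_d, iter d (fun v => v *m B) u = 0.
Proof.
case: d B => [|d] B eig0 u; first exact: thinmx0.
have iterE m : iter m (fun v => v *m B) u = u *m (B ^+ m).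
  by elim: m => [|m /= ->]; rewrite ?expr0 ?mulmx1 // exprSr mulmxA.
rewrite iterE.
have [s sE] := closed_field_poly_normal (char_poly B).
have s0 : s = nseq (size s) 0.
  apply/all_pred1P/allP => z zs /=; apply/eqP; apply: eig0.
  rewrite eigenvalue_root_char sE (monicP (char_poly_monic B)) scale1r.
  by rewrite root_prod_XsubC.
have chX : char_poly B = 'X^(d.+1).
  move: sE; rewrite (monicP (char_poly_monic B)) scale1r s0 big_nseq subr0.
  rewrite iter_mulr_1 => sE; rewrite sE; congr (_ ^+ _).
  by have := size_char_poly B; rewrite sE size_polyXn => -[].
have := Cayley_Hamilton B; rewrite chX rmorphXn /= horner_mx_X => ->.
by rewrite mulmx0.
Qed.

Lemma nilpotent_of_spectral_radius0 (V : vectType F) (A : 'End(V)) :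
  spectral_radius A = 0 -> forall x, iter (\dim {:V}) A x = 0.
Proof.
rewrite /spectral_radius.
set B0 := passmx.mxof _ _ A; set B := map_mx _ B0; set S := [set _ | _ in _] => supS0 x.
have eig0 mu : eigenvalue B mu -> mu = 0.
  move=> Bmu; apply: cmod0_eq; apply/eqP; rewrite eq_le cmod_ge0 andbT -supS0.
  apply: sup_ubound; last by exists mu.
  have [s sE] := closed_field_poly_normal (char_poly B).
  exists (\sum_(z <- s) cmod z) => _ [z Bz <-].
  have zs : z \in s.
    have := Bz; rewrite /= eigenvalue_root_char sE (monicP (char_poly_monic B)).
    by rewrite scale1r root_prod_XsubC.
  rewrite (big_rem z) //= lerDl.
  by apply: sumr_ge0 => *; exact: cmod_ge0.
have iterA m : passmx.rVof (vbasis {:V}) (iter m A x) =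
    iter m (fun v => v *m B0) (passmx.rVof (vbasis {:V}) x).
  by elim: m => [|m /= <-] //; rewrite (@passmx.rVof_app _ _ _ _ _ (vbasisP {:V})).
have iterB m (u : 'rV[F]_(\dim {:V})) :
    map_mx (@to_complex R k) (iter m (fun v => v *m B0) u) =
    iter m (fun v => v *m B) (map_mx (@to_complex R k) u).
  by elim: m => [|m /= <-] //; rewrite map_mxM.
apply/eqP; rewrite -(passmx.rVof_eq0 (vbasisP _)) iterA.
by rewrite -(map_mx_eq0 (@to_complex R k)) iterB nilpotent_of_eigenvalue0.
Qed.
End SpectralRadius.

(** * Stability *)

Section FiniteTimeGrowth.
Variables (R : realType) (k : base_field).
Variables (g : lieAlgebraType (scalar_field R k)) (nrm : g -> R) (n r : nat).
Variables (A : 'End({ffun 'I_n -> g})).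
Variable f : {ffun 'I_n -> g} -> {ffun 'I_r -> g} -> {ffun 'I_n -> g}.
Hypothesis hnrm : is_norm nrm.
Hypothesis hf : lie_function_with_linear_part nrm A f.

(** The radius of the ball on which the growth of [f] is controlled increases
    with [t], which is harmless over finitely many steps. *)
Lemma trajectory_linear_growth (W : nat -> {ffun 'I_r -> g}) (M : R) t : 0 <= M ->
  exists2 C, 0 <= C & forall X, is_trajectory f W X -> sum_norm nrm (X 0%N) <= M ->
    sum_norm nrm (X t) <= C * sum_norm nrm (X 0%N).
Proof.
move=> M0; elim: t => [|t [C C0 HC]].
  by exists 1 => // X _ _; rewrite mul1r.
have [D D0 HD] := lie_function_linear_growth hnrm hf (W t) (mulr_ge0 C0 M0).
exists (D * C) => [|X hX XM]; first exact: mulr_ge0.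
rewrite hX -mulrA; have XtC := HC X hX XM.
apply: le_trans (HD _ _) _; last by rewrite ler_wpM2l.
by apply: le_trans XtC _; rewrite ler_wpM2l.
Qed.
End FiniteTimeGrowth.

Theorem corollary5p7 (R : realType) (k : base_field)
    (g : lieAlgebraType (scalar_field R k)) (nrm : g -> R) (n r : nat)
    (A : 'End({ffun 'I_n -> g}))
    (f : {ffun 'I_n -> g} -> {ffun 'I_r -> g} -> {ffun 'I_n -> g})
    (h : {vspace g}) (W : nat -> {ffun 'I_r -> g})
    (hnrm : is_norm nrm)
    (hn : (1 <= n)%N) (hr : (1 <= r)%N)
    (hsolv : is_solvable g)
    (hf : lie_function_with_linear_part nrm A f)
    (heq : origin_unique_equilibrium f)
    (hideal : is_ideal h)
    (hnilp : is_nilpotent h)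
    (hder : (lie_span fullv fullv <= h)%VS)
    (hinv : preserves_lower_central h f)
    (hrho : spectral_radius A = 0)
    (hbound : exists2 beta : R, 0 <= beta &
                forall t, sum_norm nrm (W t) <= beta)
    (hWh : forall t, in_power h (W t)) :
  semiglobally_exponentially_stable nrm f W.
Proof.
move=> M M0; have [p h_nil] := hnilp.
have A_nil := nilpotent_of_spectral_radius0 hrho.
pose T := (p.+1 * \dim {:{ffun 'I_n -> g}})%N.
have nX0 X : 0 <= sum_norm nrm X := norm_ge0 (sum_norm_is_norm n hnrm) X.
have [alpha alpha0 growth] : exists2 alpha : R, 0 <= alpha &
    forall X, is_trajectory f W X -> sum_norm nrm (X 0%N) <= M ->
    forall t, (t < T)%N ->
      sum_norm nrm (X t) <= alpha * 2^-1 ^+ t * sum_norm nrm (X 0%N).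
  elim: T => [|T [alpha alpha0 growth]]; first by exists 0.
  have [C C0 HC] := trajectory_linear_growth hnrm hf W T (ltW M0).
  (* The factor [2 ^ T] compensates the decay at time [T]. *)
  exists (alpha + C * 2 ^+ T) => [|X hX XM t].
    by rewrite addr_ge0 // mulr_ge0 // exprn_ge0.
  have half0 m : 0 <= 2^-1 ^+ m :> R by rewrite exprn_ge0 // invr_ge0.
  rewrite ltnS leq_eqVlt => /orP[/eqP ->|tT].
    apply: le_trans (HC X hX XM) _; rewrite ler_wpM2r //.
    rewrite mulrDl -[C * _ * _]mulrA -exprMn divff // expr1n mulr1.
    by rewrite lerDr mulr_ge0.
  apply: le_trans (growth X hX XM t tT) _; rewrite ler_wpM2r // ler_wpM2r //.
  by rewrite lerDl mulr_ge0 // exprn_ge0.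
exists alpha, 2^-1; split=> //; first by rewrite invr_ge0 ler0n invf_lt1 // ltr1n.
move=> X hX XM t; have [|Tt] := ltnP t T; first exact: growth.
rewrite (deadbeat hnrm hf hideal hder hinv hWh hX A_nil h_nil Tt).
rewrite norm_0 ?mulr_ge0 ?exprn_ge0 ?invr_ge0 //.
exact: sum_norm_is_norm.
Qed.
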